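(* Assume there is a unique fastest program $f\in\mathcal F$ (that is, $l(f)<l(g)$ for all $g\in\mathcal F\setminus\{f\}$). If the estimator $\hat\Delta$ is upper consistent (i.e. for every ordered pair of distinct programs $(g,h)$, $\hat\Delta_n(g,h)$ is an upper consistent sequence of estimators of $\delta(g,h)$), then $$\lim_{n\to\infty}P(\text{the decision rule picks } f)=1.$$
   Context: $\mathcal F$ is a finite set of programs with $\mathrm F=|\mathcal F|\ge2$. Each program $f$ has a true expected loss $l(f)\in\mathbb R$; smaller loss means faster. For each number of runs $n$, an experiment yields real-valued random estimators $\hat L_n(f)$, $f\in\mathcal F$, on a common probability space. Put $\delta(f,g)=l(f)-l(g)$, $\hat\Delta_n(f,g)=\hat L_n(f)-\hat L_n(g)$, and noise $Z_n(f,g)=\hat\Delta_n(f,g)-\delta(f,g)$. The distribution of $Z_n$ is assumed known to the decision rule. Upper consistency: a sequence of estimators $\hat\theta_n$ of $\theta\in\mathbb R$ is upper consistent if for all $\omega>0$, $\lim_{n\to\infty}P(\hat\theta_n-\theta\le\omega)=1$. Decision rule with a fixed parameter, the decision confidence $\gamma_{\mathrm{dec}}\in[0,1]$; let $\gamma_{\mathrm{dec}}'=1-(1-\gamma_{\mathrm{dec}})/(\mathrm F-1)$. Given realized values $\hat\delta(f,g)$ of $\hat\Delta_n(f,g)$, the rule picks (at random, if there are several) any $f^*\in\mathcal F$ such that $P(\hat\delta(f^*,g)\le Z_n(f^*,g))\ge\gamma_{\mathrm{dec}}'$ for all $g\in\mathcal F\setminus\{f^*\}$ (here the realized value $\hat\delta(f^*,g)$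 is held fixed and the probability is over the noise distribution of $Z_n(f^*,g)$); if there is no such $f^*$ it abstains.
   Formalization: The formal theorem additionally assumes 0 < γ_dec' < 1, excluding only γ_dec = 1, and γ_dec = 0 with F = 2; the claim fails there (for γ_dec = 1 f can be inadmissible with probability tending to 1; for γ_dec' = 0 both programs are always admissible and the pick is random). *)

(* Defs.v *)
From HB Require Import structures.
From mathcomp Require Import all_boot all_order all_algebra.
From mathcomp Require Import all_classical all_reals all_analysis.

Set Implicit Arguments.
Unset Strict Implicit.
Unset Printing Implicit Defensive.

Import Order.TTheory GRing.Theory Num.Theory numFieldNormedType.Exports.

Local Open Scope classical_set_scope.
Local Open Scope ring_scope.

Definition upper_consistent d (T : measurableType d) (R : realType)
    (P : probability T R) (theta_hat : nat -> T -> R) (theta : R) : Prop :=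
  forall omega : R, 0 < omega ->
    P [set t | theta_hat n t - theta <= omega] @[n --> \oo] --> 1%E.

Definition delta (R : realType) (F : finType) (l : F -> R) (f g : F) : R :=
  l f - l g.

Definition Delta_hat (T : Type) (R : realType) (F : finType)
    (L : F -> T -> R) (f g : F) (t : T) : R :=
  L f t - L g t.

Definition noise (T : Type) (R : realType) (F : finType) (l : F -> R)
    (L : F -> T -> R) (f g : F) (t : T) : R :=
  Delta_hat L f g t - delta l f g.

(* Endpoint values are degenerate.  If the threshold is 0 (two programs and
   gamma_dec = 0), every program is admissible at every sample point, so the
   pick carries no information.  If it is 1 (gamma_dec = 1), a program is
   admissible only when its noise is almost surely at least the realized value,
   which consistent estimators need not satisfy for any number of runs. *)
Definition dec_threshold (R : realType) (F : finType) (gamma_dec : R) : R :=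
  1 - (1 - gamma_dec) / (#|F|%:R - 1).

(* [delta_hat] is a fixed table of realized values: the probability below is
   over the noise only. *)
Definition admissible d (T : measurableType d) (R : realType)
    (P : probability T R) (F : finType) (Z : F -> F -> T -> R)
    (threshold : R) (delta_hat : F -> F -> R) (f : F) : Prop :=
  forall g : F, g != f ->
    (threshold%:E <= P [set w | (delta_hat f g <= Z f g w)%R])%E.

(* The outcome [D t] is the picked program, or [None] when the rule abstains;
   the realized values are those of the experiment at the sample point [t].
   Nothing is imposed on the choice between several admissible programs: since
   the sample space is arbitrary, it may carry any extra randomness used to
   break ties.  The first clause makes picking a given program an event. *)
Definition decision_rule d (T : measurableType d) (R : realType)
    (P : probability T R) (F : finType) (l : F -> R) (L : F -> T -> R)
    (gamma_dec : R) (D : T -> option F) : Prop :=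
  (forall o : option F, measurable [set t | D t = o]) /\
  (forall t : T,
     let adm := admissible P (noise l L) (dec_threshold F gamma_dec)
                  (fun f g => Delta_hat L f g t) in
     match D t with
     | Some f => adm f
     | None => forall f : F, ~ adm f
     end).

(* Main.v *)
Require Import Defs.
From HB Require Import structures.
From mathcomp Require Import all_boot all_order all_algebra.
From mathcomp Require Import all_classical all_reals all_analysis.
From mathcomp Require Import lra.

Set Implicit Arguments.
Unset Strict Implicit.
Unset Printing Implicit Defensive.

Import Order.TTheory GRing.Theory Num.Theory numFieldNormedType.Exports.

Local Open Scope classical_set_scope.
Local Open Scope ring_scope.

(* The noise is antisymmetric, Z(g, h) = - Z(h, g), so upper consistency for both
   orders of every pair makes Z_n(g, h) tend to 0 in probability.  Put
   a g = (l g - l f) / 2.  Let E_n be the event that Z_n(f, g) <= a g for all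
   g <> f; a union bound gives P(E_n) -> 1.  On E_n the realized value of (f, g)
   is at most - a g and that of (g, f) at least a g.  The noise tails
   P(Z_n(f, g) >= - a g) -> 1 and P(Z_n(g, f) >= a g) -> 0 do not depend on the
   sample point, so once they have crossed the threshold, f is admissible and no
   other program is, everywhere on E_n. *)

Lemma cvg1_near_gt (R : realType) (u : nat -> \bar R) (c : R) :
  c < 1 -> u n @[n --> \oo] --> 1%E -> \forall n \near \oo, (c%:E < u n)%E.
Proof.
move=> c1 /(_ [set y | (c%:E < y)%E]); apply; apply: open_nbhs_nbhs.
by split; [exact: open_ereal_gt_ereal | rewrite /= lte_fin].
Qed.

Section probability_limits.
Context d (T : measurableType d) (R : realType) (P : probability T R).

(** Subadditivity on the complements gives [P A + P B - 1 <= P (A n B)], where [n] stands for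
    intersection, and this lower bound tends to [1 + 1 - 1]. *)
Lemma probability_cvg1_setI (A B : nat -> set T) :
  (forall n, measurable (A n)) -> (forall n, measurable (B n)) ->
  P (A n) @[n --> \oo] --> 1%E -> P (B n) @[n --> \oo] --> 1%E ->
  P (A n `&` B n) @[n --> \oo] --> 1%E.
Proof.
move=> mA mB cA cB; apply: (@squeeze_cvge _ _ _ _
  (fun n => P (A n) + P (B n) - 1)%E _ (fun=> 1%E)); last exact: cvg_cst.
  apply: nearW => n; have mAB := measurableI _ _ (mA n) (mB n).
  rewrite probability_le1// andbT.
  have : (P (~` A n `|` ~` B n) <= P (~` A n) + P (~` B n))%E.
    by apply: measureU2; exact: measurableC.
  rewrite -setCI !probability_setC//.
  rewrite -[P (A n)]fineK ?fin_num_measure// -[P (B n)]fineK ?fin_num_measure//.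
  rewrite -[P (A n `&` B n)]fineK ?fin_num_measure//.
  by rewrite -!EFinB -!EFinD !lee_fin; lra.
rewrite -[X in _ --> X](_ : (1 + 1 - 1 = 1)%E); last by rewrite addeK.
by apply: cvgeB => //; [apply: cvgeD | exact: cvg_cst].
Qed.

Lemma probability_cvg1_bigsetI (I : Type) (r : seq I) (p : pred I)
    (A : nat -> I -> set T) :
  (forall n i, p i -> measurable (A n i)) ->
  (forall i, p i -> P (A n i) @[n --> \oo] --> 1%E) ->
  P (\big[setI/setT]_(i <- r | p i) A n i) @[n --> \oo] --> 1%E.
Proof.
move=> mA cA; elim: r => [|i r IH].
  under eq_fun do rewrite big_nil probability_setT.
  exact: cvg_cst.
under eq_fun do rewrite big_cons.
case: (boolP (p i)) => // pi; apply: probability_cvg1_setI => //.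
- by move=> n; exact: mA.
- by move=> n; apply: bigsetI_measurable => j; exact: mA.
- exact: cA.
Qed.

End probability_limits.

Section noise.
Context (T : Type) (R : realType) (F : finType) (l : F -> R) (L : F -> T -> R).

Lemma Delta_hatC (g h : F) (t : T) : Delta_hat L g h t = - Delta_hat L h g t.
Proof. by rewrite /Delta_hat opprB. Qed.

Lemma deltaC (g h : F) : delta l g h = - delta l h g.
Proof. by rewrite /delta opprB. Qed.

Lemma noiseC (g h : F) (t : T) : noise l L g h t = - noise l L h g t.
Proof. by rewrite /noise Delta_hatC deltaC; lra. Qed.

End noise.

Lemma measurable_noise d (T : measurableType d) (R : realType)
    (P : probability T R) (F : finType) (l : F -> R) (L : F -> {RV P >-> R})
    (g h : F) :
  measurable_fun setT (noise l (fun k => L k) g h).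
Proof.
apply: measurable_realfun.measurable_funB; last exact: measurable_cst.
by apply: measurable_realfun.measurable_funB; exact: measurable_funPT.
Qed.

Theorem proposition13
    (R : realType) (d : measure_display) (T : measurableType d)
    (P : probability T R)
    (F : finType) (hF : (2 <= #|F|)%N)
    (l : F -> R) (L : nat -> F -> {RV P >-> R})
    (gamma_dec : R) (hgamma : 0 <= gamma_dec <= 1)
    (hthreshold : 0 < dec_threshold F gamma_dec < 1)
    (D : nat -> T -> option F)
    (hD : forall n, decision_rule P l (fun h => L n h) gamma_dec (D n))
    (f : F) (hf : forall g : F, g != f -> l f < l g)
    (hL : forall g h : F, g != h ->
       upper_consistent P (fun n => Delta_hat (fun k => L n k) g h) (delta l g h)) :
  P [set t | D n t = Some f] @[n --> \oo] --> 1%E.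
Proof.
have [tau0 tau1] := andP hthreshold; set tau := dec_threshold F gamma_dec in tau0 tau1.
pose Z n := noise l (fun k => L n k).
(* Half the gap: noise of at most [a g] leaves the realized value of [(f, g)] at most
   [- 2 * a g + a g = - a g], still bounded away from 0. *)
pose a g := delta l g f / 2.
have a0 g : g != f -> 0 < a g by move=> /hf; rewrite /a /delta; lra.
have mle n g h c : measurable [set t | Z n g h t <= c].
  by rewrite -[X in measurable X]setTI; apply: measurable_fun_le => //;
    exact: measurable_noise.
have mge n g h c : measurable [set t | c <= Z n g h t].
  by rewrite -[X in measurable X]setTI; apply: measurable_fun_le => //;
    exact: measurable_noise.
pose E n := \big[setI/setT]_(g | g != f) [set t | Z n f g t <= a g].
have cE : P (E n) @[n --> \oo] --> 1%E.
  apply: probability_cvg1_bigsetI => // g gf.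
  by apply: hL; [rewrite eq_sym | exact: a0].
have f_tail g : g != f ->
    \forall n \near \oo, (tau%:E <= P [set w | (- a g <= Z n f g w)%R])%E.
  (* The lower tail for [(f, g)] is the upper tail for the reversed pair [(g, f)]; [tau < 1] lets
     its probability pass the threshold. *)
  move=> gf; have := cvg1_near_gt tau1 (hL g f gf (a g) (a0 g gf)).
  apply: filterS => n /ltW; congr (_ <= P _)%E; apply/seteqP.
  by split=> t /=; rewrite /Z noiseC lerN2.
have g_tail g : g != f ->
    \forall n \near \oo, (P [set w | (a g <= Z n g f w)%R] < tau%:E)%E.
  (* Halving again makes [a g <= Z] disjoint from the consistency event [Z <= a g / 2]; at [a g]
     itself the two would share the boundary. The level [1 - tau] is below 1 because [0 < tau]. *)
  move=> gf; have a20 : 0 < a g / 2 by rewrite divr_gt0// a0.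
  have tau'1 : 1 - tau < 1 by lra.
  have := cvg1_near_gt tau'1 (hL g f gf _ a20).
  apply: filterS => n.
  set A := [set t | _ <= a g / 2] => tauA.
  have mA : measurable A by exact: mle.
  apply: (@le_lt_trans _ _ (P (~` A))).
    apply: le_measure; rewrite ?inE//; first exact: measurableC.
    by move=> t /= ha; apply/negP; rewrite -ltNge; move: ha a20; rewrite /Z/noise; lra.
  rewrite probability_setC//; move: tauA.
  rewrite -[P A]fineK ?fin_num_measure// -EFinB !lte_fin; lra.
have near_f : \forall n \near \oo, forall g, g != f ->
    (tau%:E <= P [set w | (- a g <= Z n f g w)%R])%E /\
    (P [set w | (a g <= Z n g f w)%R] < tau%:E)%E.
  (* Finiteness of [F] makes one bound on [n] serve all [g]. *)
  apply: filter_forall => g; case: (boolP (g == f)) => gf; first exact: nearW.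
  by apply: filterS2 (f_tail g gf) (g_tail g gf) => n.
apply: (@squeeze_cvge _ _ _ _ (P \o E) _ (fun=> 1%E)) => //; last exact: cvg_cst.
apply: filterS near_f => n tails.
have [mD ruleD] := hD n.
rewrite probability_le1// andbT; apply: le_measure; rewrite ?inE//.
  by apply: bigsetI_measurable => g _; exact: mle.
move=> t Et.
have Zt g : g != f -> Z n f g t <= a g.
  by move=> gf; move: Et; rewrite /E (bigD1 g)//= => -[].
have Delta_le g : g != f -> Delta_hat (fun k => L n k) f g t <= - a g.
  by move=> gf; have := Zt g gf; rewrite /Z /noise /a (deltaC l f g); lra.
rewrite /=; move: (ruleD t); case: (D n t) => [g|/(_ f)] /= adm.
  (* A picked [g] other than [f] already fails against the single competitor [f]: its realized value
     is at least [a g], so its tail is below [tau]. *)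
  have [->//|gf] := eqVneq g f; exfalso.
  have := adm f; rewrite eq_sym => /(_ gf); apply/negP; rewrite -ltNge.
  apply: le_lt_trans (proj2 (tails g gf)).
  apply: le_measure; rewrite ?inE//; first exact: mge.
  move=> w /=; apply: le_trans.
  by rewrite Delta_hatC lerNr Delta_le.
(* Abstention is excluded since [f] is admissible: lowering the cutoff from [- a g] to the realized
   value only enlarges the tail. *)
exfalso; apply: adm => g gf.
apply: le_trans (proj1 (tails g gf)) _.
apply: le_measure; rewrite ?inE//; first exact: mge.
by move=> w /=; apply: le_trans; exact: Delta_le.
Qed.
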